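(* Let $n\geq 6$ be an integer and let $S_n$ be the simple graph with vertex set $V(S_n)=\{j^{l}_{r} : 1\leq r\leq 4,\ 1\leq l\leq n\}$ ($4n$ distinct vertices) and edge set $$E(S_n)=\{\, j^{l}_{r}j^{l+1}_{r},\ j^{l}_{1}j^{l}_{2},\ j^{l}_{2}j^{l}_{3},\ j^{l}_{3}j^{l}_{4},\ j^{l}_{3}j^{l+1}_{2} \ :\ 1\leq r\leq 4,\ 1\leq l\leq n \,\},$$ where superscripts are taken modulo $n$ (so $j^{n+1}_r=j^1_r$). Then the fault-tolerant metric dimension of $S_n$ is $\mathrm{fdim}(S_n)=4$.
   Context: Let $\Gamma=(V,E)$ be a non-trivial, undirected, simple, connected graph, and let $d(u,v)$ denote the length of a shortest $u$–$v$ path. For a set $R=\{u^1,\dots,u^t\}\subseteq V$ (ordered), the code of a vertex $u$ with respect to $R$ is the tuple $(d(u,u^1),\dots,d(u,u^t))$. The set $R$ is a resolving set for $\Gamma$ if distinct vertices of $\Gamma$ have distinct codes with respect to $R$. A resolving set $R_f$ is fault-tolerant if $R_f\setminus\{u\}$ is also a resolving set for every $u\in R_f$. The fault-tolerant metric dimension $\mathrm{fdim}(\Gamma)$ is the minimum cardinality of a fault-tolerant resolving set of $\Gamma$. *)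

(* Defs.v *)
From mathcomp Require Import all_boot.

Set Implicit Arguments.
Unset Strict Implicit.
Unset Printing Implicit Defensive.

(* A simple graph on a finite vertex type T is a symmetric,
   irreflexive relation e : rel T. *)

Section MetricDimension.

Variables (T : finType) (e : rel T).
Implicit Types (R : {set T}) (u v w x y : T) (k : nat).

Definition has_walk k x y : bool :=
  [exists p : k.-tuple T, path e x p && (last x p == y)].

(* A shortest path repeats no vertex, so its length is below #|T|; if x and y
   are not connected, the value is #|T|. *)
Definition gdist x y : nat := find (fun k => has_walk k x y) (iota 0 #|T|).

(* The elements of R are listed in the order of enum R. *)
Definition code R u : seq nat := [seq gdist u w | w <- enum R].

Definition resolving R : bool := injectiveb (code R).

Definition fault_tolerant R : bool :=
  resolving R && [forall u in R, resolving (R :\ u)].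

(* setT is only the witness that some fault-tolerant resolving set exists,
   see fault_tolerant_setT. *)
Definition fdim : nat := #|[arg min_(R < setT | fault_tolerant R) #|R| ]|.

Lemma has_walkP k x y :
  reflect (exists p : seq T, [/\ size p = k, path e x p & last x p = y])
          (has_walk k x y).
Proof.
apply: (iffP existsP) => [[p /andP[ep /eqP lp]]|[p [sp ep lp]]].
  by exists p; split=> //; rewrite size_tuple.
by exists (tcast sp (in_tuple p)); rewrite val_tcast /= ep lp /=.
Qed.

Lemma gdist_le x p : path e x p -> gdist x (last x p) <= size p.
Proof.
move=> ep; rewrite /gdist; case: (leqP #|T| (size p)) => [le|lt].
  by apply: leq_trans (find_size _ _) _; rewrite size_iota.
rewrite leqNgt; apply/negP => /(before_find 0).
by rewrite nth_iota // add0n => /has_walkP; apply; exists p.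
Qed.

Lemma gdist_attained x y : connect e x y ->
  exists p : seq T, [/\ size p = gdist x y, path e x p & last x p = y].
Proof.
move=> /connectP[p0 /shortenP[p ep up _] ->]; apply/has_walkP.
have lt : size p < #|T| by have := max_card (mem (x :: p)); rewrite (card_uniqP up).
have hs : has (fun k => has_walk k x (last x p)) (iota 0 #|T|).
  apply/hasP; exists (size p); first by rewrite mem_iota.
  by apply/has_walkP; exists p.
have := nth_find 0 hs; rewrite nth_iota ?add0n //.
by move: hs; rewrite has_find size_iota.
Qed.

Lemma gdist_eq0 x y : (gdist x y == 0) = (x == y).
Proof.
apply/eqP/eqP => [d0|->]; last first.
  by apply/eqP; rewrite -leqn0; apply: (@gdist_le y [::]).
have T0 : 0 < #|T| by apply/card_gt0P; exists x.
have hs : has (fun k => has_walk k x y) (iota 0 #|T|).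
  by rewrite has_find size_iota; move: d0; rewrite /gdist => ->.
have := nth_find 0 hs; move: (d0); rewrite /gdist => ->; rewrite nth_iota //.
by move=> /has_walkP[[|a p] []].
Qed.

Lemma resolvingP R : reflect
  (forall u v, (forall w, w \in R -> gdist u w = gdist v w) -> u = v)
  (resolving R).
Proof.
apply: (iffP (injectiveP _)) => inj u v h; apply: inj.
  by apply/eq_in_map => w; rewrite mem_enum => /h.
by move=> w wR; move/eq_in_map: h => -> //; rewrite mem_enum.
Qed.

Lemma fault_tolerant_setT : fault_tolerant setT.
Proof.
have key R : (forall u v, u != v -> (u \in R) || (v \in R)) -> resolving R.
  move=> cov; apply/resolvingP => u v h.
  case: (eqVneq u v) => // /cov /orP[] /h d.
    by apply/eqP; rewrite eq_sym -gdist_eq0 -d gdist_eq0.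
  by apply/eqP; rewrite -gdist_eq0 d gdist_eq0.
apply/andP; split; first by apply: key => u v; rewrite !inE.
apply/forall_inP => w _; apply: key => u v; rewrite !inE !andbT.
by apply: contraR; rewrite negb_or !negbK => /andP[/eqP-> /eqP->].
Qed.

Lemma fdimP k :
  (exists2 R, fault_tolerant R & #|R| = k) ->
  (forall R, fault_tolerant R -> k <= #|R|) -> fdim = k.
Proof.
rewrite /fdim => -[R ftR <-] minR.
case: arg_minnP => [|S ftS minS]; first exact: fault_tolerant_setT.
by apply/eqP; rewrite eqn_leq minS // minR.
Qed.

End MetricDimension.

(* Indices start at 0: the pair (l, r) stands for j^(l+1)_(r+1).  ordS is the
   cyclic successor of 'I_n.  The disjuncts of S_arc are, in order, the edges
   j^l_r j^(l+1)_r, then j^l_1 j^l_2, j^l_2 j^l_3, j^l_3 j^l_4, and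
   j^l_3 j^(l+1)_2. *)
Definition S_arc (n : nat) (x y : 'I_n * 'I_4) : bool :=
  [|| (y.1 == ordS x.1) && (y.2 == x.2),
      (y.1 == x.1) && ((x.2 : nat, y.2 : nat) \in [:: (0, 1); (1, 2); (2, 3)])
    | (y.1 == ordS x.1) && ((x.2 : nat, y.2 : nat) == (2, 1))].

Definition S_graph (n : nat) : rel ('I_n * 'I_4) :=
  fun x y => S_arc x y || S_arc y x.

Lemma S_graph_sym n : symmetric (@S_graph n).
Proof. by move=> x y; rewrite /S_graph orbC. Qed.

Lemma S_graph_irr n : 1 < n -> irreflexive (@S_graph n).
Proof.
move=> n1 [l r]; rewrite /S_graph orbb /S_arc /= !eqxx /=.
have -> : (l == ordS l) = false.
  apply/eqP => /(congr1 val) /=; case: (ltnP l.+1 n) => h.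
    by rewrite modn_small // => /n_Sn.
  have -> : l.+1 = n by apply/eqP; rewrite eqn_leq h ltn_ord.
  by rewrite modnn => l0; move: h; rewrite l0 leqNgt n1.
by case: r => [[|[|[|[|r]]]] lt_r].
Qed.

Lemma S_graph_connected n x y : connect (@S_graph n) x y.
Proof.
case: n x y => [[[]]//|n] x y.
have csym : connect_sym (@S_graph n.+1).
  by apply: sym_connect_sym; apply: S_graph_sym.
suff to0 z : connect (@S_graph n.+1) (ord0, ord0) z.
  by apply: connect_trans (to0 y); rewrite csym.
case: z => l r; apply: (@connect_trans _ _ (l, ord0)).
  case: l => l; elim: l => [|l IH] lt_l.
    by rewrite (_ : Ordinal lt_l = ord0) //; apply: val_inj.
  apply: connect_trans (IH (ltnW lt_l)) (connect1 _).
  by rewrite /S_graph /S_arc -!val_eqE /= modn_small // eqxx.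
case: r => r; elim: r => [|r IH] lt_r.
  by rewrite (_ : Ordinal lt_r = ord0) //; apply: val_inj.
apply: connect_trans (IH (ltnW lt_r)) (connect1 _).
rewrite /S_graph /S_arc /= !eqxx /=.
by case: r lt_r {IH} => [|[|[|]]] //= lt_r; rewrite orbT.
Qed.

(* Main.v *)
(* Lower bound: each vertex a has at least six vertices at distance 2.  Their
   distances to another vertex b differ by at most 2 from the distance of a and
   b, so two of them have equal codes with respect to {a, b}.  Hence a resolving
   set has at least three elements, and a fault-tolerant one at least four.

   Upper bound: with h = n / 2 rounded down, any three of the vertices (0, 0),
   (1, 0), (h, 0), (h + 1, 0) resolve the graph; the explicit distances are
   piecewise linear, so this is a case analysis in linear arithmetic. *)

Require Import Defs.
From mathcomp Require Import all_boot.
From mathcomp Require Import zify.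

Set Implicit Arguments.
Unset Strict Implicit.
Unset Printing Implicit Defensive.

(** * Distances and resolving sets in an arbitrary graph *)

(** Certificate for a closed distance formula: following descending neighbours gives a walk to [w]
    of length at most [f x], and since [f] drops by at most one per edge, no walk is shorter. *)
Lemma gdistE (T : finType) (e : rel T) (f : T -> nat) (w : T) :
    (forall x, connect e x w) -> f w = 0 ->
    (forall x y, e x y -> f x <= (f y).+1) ->
    (forall x, x != w -> exists2 y, e x y & f y < f x) ->
  forall x, gdist e x w = f x.
Proof.
move=> conn fw lip desc x; apply/eqP; rewrite eqn_leq; apply/andP; split.
  suff [p [ep <- sp]] : exists p, [/\ path e x p, last x p = w & size p <= f x].
    exact: leq_trans (gdist_le ep) sp.
  have [m] := ubnP (f x); elim: m x => // m IH x fx.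
  have [->|/desc[y exy fy]] := eqVneq x w; first by exists [::].
  have [|p [ep lp sp]] := IH y; first exact: leq_trans fy _.
  by exists (y :: p); rewrite /= exy; split=> //; apply: leq_ltn_trans fy.
have [p [<- ep lp]] := gdist_attained (conn x).
elim: p x ep lp => [|y p IH] x /=; first by move=> _ ->; rewrite fw.
by case/andP=> exy ep lp; apply: leq_trans (lip _ _ exy) _; rewrite ltnS IH.
Qed.

Lemma resolvingS (T : finType) (e : rel T) (R S : {set T}) :
  R \subset S -> resolving e R -> resolving e S.
Proof.
move=> /subsetP sRS /resolvingP inj; apply/resolvingP => u v h.
by apply: inj => w /sRS; apply: h.
Qed.

Lemma gdist_sym (T : finType) (e : rel T) (x y : T) :
  symmetric e -> connect e x y -> gdist e x y = gdist e y x.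
Proof.
move=> esym; have csym := sym_connect_sym esym.
suff le u v : connect e u v -> gdist e v u <= gdist e u v.
  by move=> cxy; apply/eqP; rewrite eqn_leq !le // csym.
move=> /gdist_attained[p [<- ep <-]].
have -> : size p = size (rev (belast u p)) by rewrite size_rev size_belast.
have {2}-> : u = last (last u p) (rev (belast u p)).
  by case: p {ep} => //= z p; rewrite rev_cons last_rcons.
by apply: gdist_le; rewrite rev_path -(eq_path (e := e)) // => z t; apply: esym.
Qed.

Lemma gdist_triangle (T : finType) (e : rel T) (x y z : T) :
  connect e x y -> connect e y z -> gdist e x z <= gdist e x y + gdist e y z.
Proof.
move=> /gdist_attained[p [<- ep <-]] /gdist_attained[q [<- eq <-]].
by rewrite -size_cat -last_cat gdist_le // cat_path ep.
Qed.

(* The distances from [b] to the vertices at distance [k] from [a] differ by at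
   most [k] from that of [a], so they take at most [2 k + 1] values. *)
Lemma pair_not_resolving (T : finType) (e : rel T) (a b : T) (U : seq T) k :
    symmetric e -> (forall x y, connect e x y) ->
    {in U, forall u, gdist e u a = k} ->
    uniq U -> k.*2.+1 < size U -> ~~ resolving e [set a; b].
Proof.
move=> esym conn Ua uU sU; apply/negP => /resolvingP inj.
move: sU; rewrite ltnNge => /negP; apply.
(* Since [a] separates no two members of [U], the distances to [b] must be distinct, yet all lie in
   this interval. If the left end truncates to 0, the interval still reaches past
   [gdist e a b + k]. *)
rewrite -(size_map (gdist e ^~ b)) -(size_iota (gdist e a b - k) k.*2.+1).
apply: uniq_leq_size => [|_ /mapP[u uin ->]]; last first.
  have := gdist_triangle (conn u a) (conn a b).
  have := gdist_triangle (conn a u) (conn u b).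
  by rewrite (gdist_sym esym (conn a u)) Ua // mem_iota; lia.
rewrite map_inj_in_uniq // => u v uU' vU /= duv; apply: inj => w.
by rewrite !inE => /orP[] /eqP-> //; rewrite !Ua.
Qed.

(** * Closed formula for the distances in [S_graph] *)

Definition cyc_off n (l m : 'I_n) : nat := if m <= l then l - m else l + n - m.

Lemma cyc_offS n (l m : 'I_n) : cyc_off (ordS l) m =
  if (cyc_off l m).+1 == n then 0 else (cyc_off l m).+1.
Proof.
have lt_l := ltn_ord l; have lt_m := ltn_ord m; rewrite /cyc_off /=.
have [h|h] := ltnP l.+1 n.
  by rewrite modn_small //; case: (leqP m l); case: (leqP m l.+1); case: eqP; lia.
have -> : l.+1 = n by lia.
by rewrite modnn; case: (leqP m l); case: (leqP m 0); case: eqP; lia.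
Qed.

Lemma cyc_off_pred n (l m : 'I_n) : cyc_off (ord_pred l) m =
  if cyc_off l m == 0 then n.-1 else (cyc_off l m).-1.
Proof.
have lt_o : cyc_off (ord_pred l) m < n.
  by have := ltn_ord (ord_pred l); have := ltn_ord m; rewrite /cyc_off; case: (leqP m); lia.
by rewrite -{2 3}(ord_predK l) cyc_offS; case: (_.+1 =P n) => /=; lia.
Qed.

Lemma ltn_cyc_off n (l m : 'I_n) : cyc_off l m < n.
Proof. by have := ltn_ord l; have := ltn_ord m; rewrite /cyc_off; case: (leqP m); lia. Qed.

Lemma cyc_off_eq0 n (l m : 'I_n) : cyc_off l m = 0 -> l = m.
Proof.
move=> h; apply: val_inj => /=; move: h.
by have := ltn_ord l; have := ltn_ord m; rewrite /cyc_off; case: (leqP m); lia.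
Qed.

(* The distance from (l, r) to (m, s) when k = l - m modulo n.  The diagonal edge
   between layers 1 and 2 saves one step around the cycle, in one direction
   only, and only if r and s lie on different sides of it. *)
Definition Sdist_off n k r s : nat :=
  (r - s) + (s - r) +
  if r <= 1 then if s <= 1 then minn k (n - k) else minn k.-1 (n - k)
  else if s <= 1 then minn k (n.-1 - k) else minn k (n - k).

Definition Sdist n (x w : 'I_n * 'I_4) : nat :=
  Sdist_off n (cyc_off x.1 w.1) x.2 w.2.

(** A diagonal arc changes offset and layer at once, but it also switches the branch of [Sdist_off],
    which keeps the total change within one. *)
Lemma Sdist_arc n (x y w : 'I_n * 'I_4) : S_arc x y ->
  Sdist x w <= (Sdist y w).+1 /\ Sdist y w <= (Sdist x w).+1.
Proof.
case: x y w => [l r] [l' r'] [m s]; rewrite /S_arc /Sdist /=.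
have := ltn_cyc_off l m; set k := cyc_off l m => lt_k.
have lt_r := ltn_ord r; have lt_s := ltn_ord s.
case/or3P => /andP[/eqP->].
- move=> /eqP ->; rewrite cyc_offS -/k /Sdist_off.
  by case: (leqP r 1) => ?; case: (leqP s 1) => ?; case: (k.+1 =P n) => ?; lia.
- rewrite !inE !xpair_eqE -/k /Sdist_off.
  by case/or3P => /andP[/eqP-> /eqP->]; case: (leqP s 1) => ? /=; lia.
rewrite xpair_eqE => /andP[/eqP-> /eqP->]; rewrite cyc_offS -/k /Sdist_off /=.
by case: (leqP s 1) => ?; case: (k.+1 =P n) => ?; lia.
Qed.

Lemma Sdist_lip n (x y w : 'I_n * 'I_4) : S_graph x y ->
  Sdist x w <= (Sdist y w).+1.
Proof. by case/orP => /Sdist_arc - /(_ w) []. Qed.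

Lemma S_graph_ordS n (l : 'I_n) r : S_graph (l, r) (ordS l, r).
Proof. by rewrite /S_graph /S_arc /= !eqxx. Qed.

Lemma S_graph_ord_pred n (l : 'I_n) r : S_graph (l, r) (ord_pred l, r).
Proof. by rewrite -{1}(ord_predK l) S_graph_sym S_graph_ordS. Qed.

Lemma S_graph_layerS n (l : 'I_n) (r s : 'I_4) : s = r.+1 :> nat ->
  S_graph (l, r) (l, s).
Proof.
rewrite /S_graph /S_arc /= !inE !xpair_eqE eqxx => rs.
by have := ltn_ord s; case: (_ == ordS l) => //=; lia.
Qed.

Lemma S_graph_diag n (l : 'I_n) (r s : 'I_4) : r = 2 :> nat -> s = 1 :> nat ->
  S_graph (l, r) (ordS l, s).
Proof. by rewrite /S_graph /S_arc /= => -> ->; rewrite !eqxx !orbT. Qed.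

(** Contrapositive of the descent condition in [gdistE]: assuming minimality against all six kinds
    of neighbour avoids naming the closer one in each case. *)
Lemma Sdist_descent n (x w : 'I_n * 'I_4) :
  (forall y, S_graph x y -> Sdist x w <= Sdist y w) -> x = w.
Proof.
case: x w => [l r] [m s] min_x.
have lt_k := ltn_cyc_off l m; have lt_r := ltn_ord r; have lt_s := ltn_ord s.
suff [/cyc_off_eq0-> rs] : cyc_off l m = 0 /\ r = s :> nat.
  by congr (_, _); apply: val_inj.
have := min_x _ (S_graph_ordS l r); have := min_x _ (S_graph_ord_pred l r).
have up (r' : 'I_4) : r' = r.+1 :> nat ->
    Sdist (l, r) (m, s) <= Sdist (l, r') (m, s).
  by move=> e; apply: min_x; apply: S_graph_layerS.
have down (r' : 'I_4) : r = r'.+1 :> nat ->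
    Sdist (l, r) (m, s) <= Sdist (l, r') (m, s).
  by move=> e; apply: min_x; rewrite S_graph_sym S_graph_layerS.
have diag (r' : 'I_4) : r = 2 :> nat -> r' = 1 :> nat ->
    Sdist (l, r) (m, s) <= Sdist (ordS l, r') (m, s).
  by move=> e e'; apply: min_x; apply: S_graph_diag.
have antidiag (r' : 'I_4) : r = 1 :> nat -> r' = 2 :> nat ->
    Sdist (l, r) (m, s) <= Sdist (ord_pred l, r') (m, s).
  move=> e e'; apply: min_x; rewrite S_graph_sym -{2}(ord_predK l).
  exact: S_graph_diag.
(* All candidate layers are supplied before [r] is known; the premises on layers select the relevant
   ones after the case split. *)
have {up} := (up (inord 1), up (inord 2), up (inord 3)).
have {down} := (down (inord 0), down (inord 1), down (inord 2)).
have {diag} := diag (inord 1); have {antidiag} := antidiag (inord 2).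
rewrite /Sdist /= !inordK // !cyc_off_pred !cyc_offS.
move: (cyc_off l m) lt_k => k lt_k {min_x}.
by case: r lt_r => [[|[|[|[|r]]]] ?] //= _;
  case: s lt_s => [[|[|[|[|s]]]] ?] //= _; rewrite /Sdist_off /=;
  case: (k =P 0) => ?; case: (k.+1 =P n) => ? ? ? [[? ?] ?] [[? ?] ?] ? ?; lia.
Qed.

Lemma S_gdistE n (x w : 'I_n * 'I_4) : gdist (@S_graph n) x w = Sdist x w.
Proof.
apply: (gdistE (f := (@Sdist n)^~ w)) => [y||y z|y neq].
- exact: S_graph_connected.
- by rewrite /Sdist /Sdist_off /cyc_off leqnn !subnn !min0n; do 2 case: ifP.
- exact: Sdist_lip.
case: (pickP (fun z => S_graph y z && (Sdist z w < Sdist y w))) => [z /andP[]|no].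
  by exists z.
case/eqP: neq; apply: Sdist_descent => z yz.
by have := no z; rewrite yz /= ltnNge => /negbFE.
Qed.

(** * Lower bound *)

Lemma S_pair_not_resolving n (a b : 'I_n * 'I_4) : 4 < n ->
  ~~ resolving (@S_graph n) [set a; b].
Proof.
case: a => m s n4.
(* [s1] is the adjacent layer on the same side of the diagonal edges, [s2] a layer two away on the
   other side. The column [m2] is the one where the diagonal saves a step, so [(m2, s2)] is also at
   distance 2. *)
pose s1 : 'I_4 := inord (if odd s then s.-1 else s.+1).
pose s2 : 'I_4 := inord (if s <= 1 then s.+2 else s.-2).
pose m2 := if s <= 1 then ord_pred m else ordS m.
pose U := [:: (ordS (ordS m), s); (ord_pred (ord_pred m), s);
              (ordS m, s1); (ord_pred m, s1); (m, s2); (m2, s2)].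
have lt_s := ltn_ord s.
have s1E : s1 = (if odd s then s.-1 else s.+1) :> nat.
  by rewrite inordK //; case: s lt_s {s1 s2 m2 U} => [[|[|[|[|s]]]] ?].
have s2E : s2 = (if s <= 1 then s.+2 else s.-2) :> nat.
  by rewrite inordK //; case: s lt_s {s1 s2 m2 U s1E} => [[|[|[|[|s]]]] ?].
have off0 : cyc_off m m = 0 by rewrite /cyc_off leqnn subnn.
have off1 : cyc_off (ordS m) m = 1.
  by rewrite cyc_offS off0; case: eqP => //; lia.
have off2 : cyc_off (ordS (ordS m)) m = 2.
  by rewrite cyc_offS off1; case: eqP => //; lia.
have off_1 : cyc_off (ord_pred m) m = n.-1 by rewrite cyc_off_pred off0.
have off_2 : cyc_off (ord_pred (ord_pred m)) m = n.-2.
  by rewrite cyc_off_pred off_1; case: eqP => //; lia.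
have offm2 : cyc_off m2 m = if s <= 1 then n.-1 else 1.
  by rewrite /m2; case: ifP.
apply: (@pair_not_resolving _ _ _ _ U 2) => //.
- exact: S_graph_sym.
- exact: S_graph_connected.
- move=> u; rewrite S_gdistE /Sdist !inE; do 5?[case/orP]; move/eqP=> -> /=;
    rewrite ?(off0, off1, off2, off_1, off_2, offm2) ?s1E ?s2E;
    by case: (s : nat) lt_s => [|[|[|[|]]]] //= _; rewrite /Sdist_off /=; lia.
(* Distinctness is read off from offset and layer; [4 < n] keeps the offsets 2 and [n.-2] apart. *)
apply: (@map_uniq _ _ (fun u : 'I_n * 'I_4 => (cyc_off u.1 m, u.2 : nat))).
rewrite /= !inE !xpair_eqE off0 off1 off2 off_1 off_2 offm2 s1E s2E.
case: (n) n4 => [|[|[|[|[|k]]]]] //= _.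
by case: (s : nat) lt_s => [|[|[|[|]]]] //= _; rewrite ?andbF.
Qed.

Lemma S_resolving_card n (R : {set 'I_n * 'I_4}) : 4 < n ->
  resolving (@S_graph n) R -> 2 < #|R|.
Proof.
move=> n4 resR; rewrite ltnNge; apply/negP => cR.
suff [a [b sR]] : exists a b, R \subset [set a; b].
  by have /negP := S_pair_not_resolving a b n4; apply; apply: resolvingS resR.
(* The default [o] fills the pair when [R] has fewer than two elements. *)
pose o : 'I_n * 'I_4 := (Ordinal (ltn_trans (isT : 0 < 4) n4), ord0).
exists (nth o (enum R) 0), (nth o (enum R) 1); apply/subsetP => x.
rewrite -mem_enum !inE; move: cR; rewrite cardE.
by case: (enum R) => [|a [|b []]] //= _; rewrite !inE // => ->.
Qed.

Lemma S_fault_tolerant_card n (R : {set 'I_n * 'I_4}) : 4 < n ->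
  fault_tolerant (@S_graph n) R -> 3 < #|R|.
Proof.
move=> n4 /andP[/(S_resolving_card n4) R2 /forall_inP ft].
have /card_gt0P[x xR] : 0 < #|R| by apply: leq_trans R2.
by rewrite (cardsD1 x) xR; apply: S_resolving_card (ft _ xR).
Qed.

(** * Upper bound *)

Definition Sdist0 n m l r : nat :=
  Sdist_off n (if m <= l then l - m else l + n - m) r 0.

(** The four indices are the distances to columns 0, 1, [h], [h.+1] of layer 0, each linear on every
    range. For layers 2 and 3 the turning point comes one column earlier, because the diagonal
    shortens one way around. *)
Variant Sdist0_spec n h l r : nat -> nat -> nat -> nat -> Prop :=
| SdistIn0 of r <= 1 & l = 0 :
    Sdist0_spec n h l r r r.+1 (h + r) (n - h.+1 + r)
| SdistInL of r <= 1 & 0 < l <= h :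
    Sdist0_spec n h l r (l + r) (l.-1 + r) (h - l + r) (h.+1 - l + r)
| SdistInM of r <= 1 & l = h.+1 :
    Sdist0_spec n h l r (n - l + r) (h + r) r.+1 r
| SdistInR of r <= 1 & h.+1 < l :
    Sdist0_spec n h l r (n - l + r) (n - l + r.+1) (l - h + r) (l - h.+1 + r)
| SdistOut0 of 1 < r & l = 0 :
    Sdist0_spec n h l r r r (h.-1 + r) (n - h.+1 + r)
| SdistOutL of 1 < r & 0 < l < h :
    Sdist0_spec n h l r (l + r) (l.-1 + r) (h.-1 - l + r) (h - l + r)
| SdistOutM of 1 < r & l = h :
    Sdist0_spec n h l r (n.-1 - h + r) (h.-1 + r) r r
| SdistOutR of 1 < r & h < l :
    Sdist0_spec n h l r (n.-1 - l + r) (n - l + r) (l - h + r) (l - h.+1 + r).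

Lemma Sdist0P n h l r : 6 <= n -> h.*2 <= n <= h.*2.+1 -> l < n ->
  Sdist0_spec n h l r (Sdist0 n 0 l r) (Sdist0 n 1 l r)
                      (Sdist0 n h l r) (Sdist0 n h.+1 l r).
Proof.
move=> n6 hn lt_l; rewrite /Sdist0 /Sdist_off /= subn0 sub0n !addn0.
case: (leqP r 1) => r1; case: (posnP l) => l0.
- have := SdistIn0 n h r1 l0; congr Sdist0_spec;
      case: (leqP h l); case: (ltnP h l); lia.
- case: (ltngtP l h.+1) => lh.
  + have lh' : 0 < l <= h by lia.
    have := SdistInL n r1 lh'; congr Sdist0_spec;
      case: (leqP h l); case: (ltnP h l); lia.
  + have := SdistInR n r1 lh; congr Sdist0_spec;
      case: (leqP h l); case: (ltnP h l); lia.
  + have := SdistInM n r1 lh; congr Sdist0_spec;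
      case: (leqP h l); case: (ltnP h l); lia.
- have := SdistOut0 n h r1 l0; congr Sdist0_spec;
      case: (leqP h l); case: (ltnP h l); lia.
case: (ltngtP l h) => lh.
- have lh' : 0 < l < h by lia.
  have := SdistOutL n r1 lh'; congr Sdist0_spec;
      case: (leqP h l); case: (ltnP h l); lia.
- have := SdistOutR n r1 lh; congr Sdist0_spec;
      case: (leqP h l); case: (ltnP h l); lia.
- have := SdistOutM n r1 lh; congr Sdist0_spec;
      case: (leqP h l); case: (ltnP h l); lia.
Qed.

(** Each triple contains 0 and 1, or [h] and [h.+1], plus one landmark of the other pair. On the
    ranges L and R, the adjacent two tell the sides apart; on a given side, the sum of the distances
    to landmarks of different pairs determines the layer, and their difference then the column. *)
Lemma Sdist0_inj n h l l' r r' : 6 <= n -> h.*2 <= n <= h.*2.+1 ->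
    l < n -> l' < n -> r < 4 -> r' < 4 ->
    let d m := Sdist0 n m l r = Sdist0 n m l' r' in
    [\/ [/\ d 0, d 1 & d h], [/\ d 0, d 1 & d h.+1],
        [/\ d 0, d h & d h.+1] | [/\ d 1, d h & d h.+1]] ->
  l = l' /\ r = r'.
Proof.
move=> n6 hn lt_l lt_l' lt_r lt_r' /=.
case: (Sdist0P r n6 hn lt_l) => ? ?;
  case: (Sdist0P r' n6 hn lt_l') => ? ? [] [? ? ?]; lia.
Qed.

Lemma S_fault_tolerant_exists n : 6 <= n ->
  exists2 R, fault_tolerant (@S_graph n) R & #|R| = 4.
Proof.
case: n => // n n6; pose h := n.+1./2; have hn : h.*2 <= n.+1 <= h.*2.+1 by lia.
pose P := [:: 0; 1; h; h.+1].
pose p m : 'I_n.+1 * 'I_4 := (inord m, ord0).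
have Pn m : m \in P -> m < n.+1 by rewrite !inE; do 3?[case/orP] => /eqP->; lia.
have p_inj : {in P &, injective p}.
  move=> i j /Pn lt_i /Pn lt_j [/(congr1 (@nat_of_ord _))].
  by rewrite !inordK.
have uP : uniq P by rewrite /= !inE; lia.
have distE x m : m \in P -> gdist (@S_graph n.+1) x (p m) = Sdist0 n.+1 m x.1 x.2.
  by move=> /Pn lt_m; rewrite S_gdistE /Sdist /cyc_off /= inordK.
(* Here [w] is arbitrary: if it is not a landmark all four distances agree, otherwise the three
   remaining ones do. *)
have ft w : resolving (@S_graph n.+1) ([set:: map p P] :\ w).
  apply/resolvingP => u v duv.
  have d m : m \in P -> p m != w ->
      Sdist0 n.+1 m u.1 u.2 = Sdist0 n.+1 m v.1 v.2.
    by move=> mP mw; rewrite -!distE // duv // in_setD1 mw in_set map_f.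
  suff [e1 e2] : u.1 = v.1 :> nat /\ u.2 = v.2 :> nat.
    rewrite [u]surjective_pairing [v]surjective_pairing.
    by rewrite (val_inj e1) (val_inj e2).
  apply: (Sdist0_inj n6 hn) => //.
  have [/allP neq|/allPn[m mP /negbNE/eqP mw]] := boolP (all (fun m => p m != w) P).
    by constructor 1; split; apply: d; rewrite ?neq ?inE ?eqxx ?orbT.
  have {}d k : k \in P -> k != m ->
      Sdist0 n.+1 k u.1 u.2 = Sdist0 n.+1 k v.1 v.2.
    by move=> kP km; apply: d => //; rewrite -mw (inj_in_eq p_inj).
  have : m \in P := mP; rewrite !inE => /or4P[] /eqP mE.
  - by constructor 4; split; apply: d; rewrite ?inE ?eqxx ?orbT // mE; lia.
  - by constructor 3; split; apply: d; rewrite ?inE ?eqxx ?orbT // mE; lia.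
  - by constructor 2; split; apply: d; rewrite ?inE ?eqxx ?orbT // mE; lia.
  - by constructor 1; split; apply: d; rewrite ?inE ?eqxx ?orbT // mE; lia.
exists [set:: map p P]; last first.
  have /card_uniqP : uniq (map p P) by rewrite map_inj_in_uniq.
  by rewrite cardsE.
apply/andP; split; last by apply/forall_inP => w _; apply: ft.
(* The full set resolves because it contains a resolving subset. *)
by apply: resolvingS (ft (p 0)); apply: subsetDl.
Qed.

Theorem theorem0p3 (n : nat) (hn : 6 <= n) : fdim (@S_graph n) = 4.
Proof.
apply: fdimP; first exact: S_fault_tolerant_exists.
by move=> R; apply: S_fault_tolerant_card; lia.
Qed.
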